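(* Let $\rho = (1,k-1,1)$. For every integer $k \geq 1$, $$C_{3,3}^k = \vert \mathbb{S}(3^3,\rho) \vert = \frac{9k^4 - 2k^3 + 9k^2}{4} + 1.$$
   Context: $n^3$ denotes the three-row rectangular shape $(n,n,n)$. The Young diagram of shape $\lambda=(\lambda_1,\dots,\lambda_m)$ is the left-justified array with $\lambda_i$ cells in the $i$-th row from the top; $(i,j)$ is the cell in row $i$, column $j$. $\mathbb{S}(\lambda,\rho)$ is the set of standard set-valued Young tableaux of shape $\lambda$ and row-constant density $\rho=(\rho_1,\dots,\rho_m)$: assignments of the integers $1,\dots,M$, $M=\sum_i\lambda_i\rho_i$, to the cells so that each cell in row $i$ receives precisely $\rho_i$ integers (unordered within the cell), and for each cell $(i,j)$ every integer in it is smaller than every integer in the cells $(i+1,j)$ and $(i,j+1)$. In the degenerate case $k=1$ the middle-row cells are empty and the tableaux are identified with standard Young tableaux formed by the first and third rows, i.e. the order condition is read as: every integer in cell $(i,j)$ is smaller than every integer in any other cell $(i',j')$ with $i'\ge i$, $j'\ge j$ (for positive densities this is equivalent to the condition above). The numbers $C^k_{3,n} := \vert \mathbb{S}(n^3,\rho)\vert$ with $\rho=(1,k-1,1)$ are called the three-dimensional $k$-Catalan numbers. *)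

(* Defs.v *)
From mathcomp Require Import all_boot.

Set Implicit Arguments.
Unset Strict Implicit.
Unset Printing Implicit Defensive.

Section SetValuedTableaux.

Variables (m : nat) (lam rho : m.-tuple nat).

(* Rows and columns are numbered from 0. *)
Definition cell : finType := {i : 'I_m & 'I_(tnth lam i)}.
Definition row_of (c : cell) : 'I_m := tag c.
Definition col_of (c : cell) : nat := tagged c.

(* The number M of integers to be placed. *)
Definition weight : nat := \sum_(i < m) tnth lam i * tnth rho i.

(* A filling sends each integer to the cell containing it;
   x : 'I_weight stands for the integer x.+1 of {1, ..., M}. *)
Definition filling : finType := {ffun 'I_weight -> cell}.

Definition content (T : filling) (c : cell) : {set 'I_weight} :=
  [set x | T x == c].

Definition has_density (T : filling) : bool :=
  [forall c, #|content T c| == tnth rho (row_of c)].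

Definition lt_content (T : filling) (c d : cell) : bool :=
  [forall x in content T c, forall y in content T d, x < y].

Definition weakly_se (c d : cell) : bool :=
  (row_of c <= row_of d) && (col_of c <= col_of d).

Definition next_to (c d : cell) : bool :=
  ((row_of d == (row_of c).+1 :> nat) && (col_of d == col_of c)) ||
  ((row_of d == row_of c) && (col_of d == (col_of c).+1)).

(* The comparison ranges over all pairs of cells, not only adjacent ones, so
   that empty cells (zero densities) do not cut the order into pieces. For
   positive densities nothing changes: see standardP_adjacent below. *)
Definition standard (T : filling) : bool :=
  [forall c, forall d, (c != d) && weakly_se c d ==> lt_content T c d].

Definition ssvyt : {set filling} := [set T | has_density T && standard T].

Lemma standardP_adjacent (T : filling) :
    (forall i j : 'I_m, i <= j -> tnth lam j <= tnth lam i) ->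
    (forall i : 'I_m, 0 < tnth rho i) -> has_density T ->
  standard T = [forall c, forall d, next_to c d ==> lt_content T c d].
Proof.
move=> lamP rhoP /forallP densT.
have ltT c d e : lt_content T c d -> lt_content T d e -> lt_content T c e.
  move=> /forall_inP cd /forall_inP de.
  have /card_gt0P [y yd] : 0 < #|content T d| by rewrite (eqP (densT d)).
  apply/forall_inP => x xc; apply/forall_inP => z ze.
  exact: ltn_trans (forall_inP (cd x xc) y yd) (forall_inP (de y yd) z ze).
apply/idP/idP => /forallP stT; apply/forallP => c; apply/forallP => d;
    apply/implyP.
  move=> cd; apply: (implyP (forallP (stT c) d)).
  have [ecd | _] := eqVneq c d.
    by move: cd; rewrite ecd /next_to !(ltn_eqF (ltnSn _)) andbF.
  case/orP: cd => /andP [/eqP rE /eqP cE]; rewrite /weakly_se cE rE ?leqnn //.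
    by rewrite leqnSn.
  by rewrite leqnSn.
have adj e f : next_to e f -> lt_content T e f.
  exact: implyP (forallP (stT e) f).
have {stT} : forall n (e f : cell), e != f -> weakly_se e f ->
    (row_of f - row_of e) + (col_of f - col_of e) = n -> lt_content T e f.
  elim=> [|n IHn] [i a] [j b]; rewrite /weakly_se /row_of /col_of /=.
    move=> /eqP nef /andP [le_ij le_ab] /eqP.
    rewrite addn_eq0 !subn_eq0 => /andP [le_ji le_ba]; case: nef.
    have eij : i = j by apply/val_inj/eqP; rewrite eqn_leq le_ij.
    subst j; congr existT; apply/val_inj/eqP; by rewrite eqn_leq le_ab.
  move=> _ /andP [le_ij le_ab] dE.
  have step (g : cell) : next_to (existT _ i a) g -> weakly_se g (existT _ j b) ->
      (j - row_of g) + (b - col_of g) = n ->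
      lt_content T (existT _ i a) (existT _ j b).
    move=> ig gj gE; have [<- | ngj] := eqVneq g (existT _ j b).
      exact: adj.
    exact: ltT (adj _ _ ig) (IHn _ _ ngj gj gE).
  have [lt_ij | le_ji] := ltnP i j.
    have i1m : i.+1 < m := leq_ltn_trans lt_ij (ltn_ord j).
    have a_lt : a < tnth lam (Ordinal i1m).
      exact: leq_trans (leq_ltn_trans le_ab (ltn_ord b)) (lamP (Ordinal i1m) j lt_ij).
    apply: (step (existT _ (Ordinal i1m) (Ordinal a_lt)));
      rewrite /next_to /weakly_se /row_of /col_of /= ?eqxx ?lt_ij //.
    by apply: succn_inj; rewrite -addSn subnSK.
  have eij : i = j by apply/val_inj/eqP; rewrite eqn_leq le_ij.
  subst j; move: dE; rewrite subnn add0n => dE.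
  have lt_ab : a < b by rewrite -subn_gt0 dE.
  have a1 : a.+1 < tnth lam i := leq_ltn_trans lt_ab (ltn_ord b).
  apply: (step (existT _ i (Ordinal a1)));
    rewrite /next_to /weakly_se /row_of /col_of /= ?eqxx ?orbT ?leqnn //.
  by rewrite subnn add0n subnS dE.
by move=> step /andP [ncd scd]; apply: (step _ _ _ ncd scd erefl).
Qed.

End SetValuedTableaux.

(* The three-dimensional k-Catalan number C^k_{3,n}, for k >= 1. *)
Definition Catalan3 (k n : nat) : nat :=
  #|ssvyt [tuple n; n; n] [tuple 1; k.-1; 1]|.

(* Main.v *)
Require Import Defs.
From mathcomp Require Import all_boot all_order all_algebra.
From mathcomp Require Import zify lra.
Import GRing.Theory.
Local Open Scope ring_scope.

(** Read the integers 1, ..., M in increasing order and record only the row of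
    each. The middle row is filled from left to right, so a tableau is
    determined by the positions of its top entries a1 < a2 < a3 and its bottom
    entries c1 < c2 < c3; here a1 = 0 and c3 = M - 1 = 3r + 5 with r = k - 1
    (integers are numbered from 0). The column conditions say that at most r
    (resp. 2r) middle entries precede a2 (resp. a3), that at least r (resp. 2r)
    of them precede c1 (resp. c2), and that a2 < c2 (which follows from the rest
    unless r = 0). Exactly five interleavings of a2 < a3 with c1 < c2 are
    possible; each contributes a polynomial in k. *)

(** * Ranks of naturals relative to a subset *)

Section Rank.
Local Open Scope nat_scope.
Variable S : pred nat.

Definition rank (n : nat) : nat := \sum_(0 <= i < n) S i.

Lemma rank0 : rank 0 = 0. Proof. by rewrite /rank big_geq. Qed.

Lemma rankS n : rank n.+1 = rank n + S n.
Proof. by rewrite /rank big_nat_recr. Qed.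

Lemma leq_rank m n : m <= n -> rank m <= rank n.
Proof.
move=> /subnK <-; elim: (n - m) => // d IHd.
by rewrite addSn rankS; apply: leq_trans IHd (leq_addr _ _).
Qed.

Lemma ltn_rank m n : S m -> m < n -> rank m < rank n.
Proof. by move=> Sm /leq_rank; rewrite rankS Sm addn1. Qed.

(** Along [S] the rank runs through 0, 1, 2, ... without gaps or repetitions. Applied with l = j r
    and u = (j+1) r, this gives the density of the middle cell in column j. *)
Lemma card_rank_band n l u : l <= u -> u <= rank n ->
  #|[set x : 'I_n | [&& S x, l <= rank x & rank x < u]]| = u - l.
Proof.
move=> le_lu; rewrite -sum1dep_card big_mkcond /=.
rewrite -(big_mkord xpredT (fun x => if [&& S x, l <= rank x & rank x < u] then 1 else 0)).
(* Capping both ends at [rank n] removes the bound on [u], which would not survive the induction on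
   n. *)
suff -> : \sum_(0 <= x < n) (if [&& S x, l <= rank x & rank x < u] then 1 else 0)
    = minn (rank n) u - minn (rank n) l by lia.
elim: n => [|n IHn]; first by rewrite big_geq // rank0; lia.
rewrite big_nat_recr //= IHn rankS.
by case: (S n) => /=; [case: ifP|]; lia.
Qed.

Lemma card_rank n x : x <= n -> #|[set y : 'I_n | S y && (y < x)]| = rank x.
Proof.
move=> le_xn; rewrite -sum1dep_card big_mkcond /=.
rewrite -(big_mkord xpredT (fun y => if S y && (y < x) then 1 else 0)).
rewrite (big_cat_nat (n := x)) //= [X in _ + X]big_nat_cond.
rewrite [X in _ + X]big1 => [|i /andP [/andP [le_xi _] _]]; last first.
  by rewrite ltnNge le_xi andbF.
rewrite addn0 /rank; apply: eq_big_nat => i /andP [_ ->].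
by rewrite andbT; case: (S i).
Qed.
End Rank.

(** * Counting the admissible quadruples *)

Section Counting.
Local Open Scope nat_scope.

Definition band (l u x : nat) : bool := l <= x < u.

Lemma sum_band n l u (F : nat -> nat) : u <= n ->
  \sum_(x < n) band l u x * F x = \sum_(l <= x < u) F x.
Proof.
move=> le_un.
rewrite -(big_mkord xpredT (fun x => band l u x * F x)) (big_nat_widenl l 0) //.
rewrite (big_nat_widen _ _ _ _ _ le_un) [RHS]big_mkcond /=; apply: eq_bigr => x _.
by rewrite /band; case: (l <= x); case: (x < u); rewrite ?mul1n ?mul0n.
Qed.

Lemma sum_band1 n l u : u <= n -> \sum_(x < n) band l u x = u - l.
Proof.
move=> le_un; rewrite -[RHS]muln1 -sum_nat_const_nat -(@sum_band n) //.
by apply: eq_bigr => x _; rewrite muln1.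
Qed.

(* The disjuncts are the interleavings aacc, acac, acca, caac, caca of a2 < a3
   with c1 < c2. The arguments are ordered so that, within each of them, the
   range of a2 depends only on a3 and that of c2 only on c1. *)
Definition admissible (r a3 c1 a2 c2 : nat) : bool :=
  [|| [&& band 2 (2 * r + 3) a3, band (maxn a3.+1 (r + 3)) (3 * r + 4) c1,
          band 1 (minn a3 (r + 2)) a2 & band (maxn c1.+1 (2 * r + 4)) (3 * r + 5) c2],
      [&& band (r + 3) (2 * r + 4) a3, band (r + 2) a3 c1,
          band 1 (r + 2) a2 & band (2 * r + 4) (3 * r + 5) c2],
      [&& band (2 * r + 4) (2 * r + 5) a3, band (r + 2) (2 * r + 3) c1,
          band 1 (r + 2) a2 & band (2 * r + 3) (2 * r + 4) c2],
      [&& band (r + 3) (2 * r + 4) a3, band (r + 1) (r + 2) c1,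
          band (r + 2) (r + 3) a2 & band (2 * r + 4) (3 * r + 5) c2] |
      [&& band (2 * r + 4) (2 * r + 5) a3, band (r + 1) (r + 2) c1,
          band (r + 2) (r + 3) a2 & band (2 * r + 3) (2 * r + 4) c2]].

(** The last block holds the column conditions, with the number of middle entries before x rewritten
    as x minus the number of outer entries before x. *)
Lemma admissibleP r a3 c1 a2 c2 :
  reflect [/\ [/\ 0 < a2, a2 < a3 & a3 < 3 * r + 5], [/\ 0 < c1, c1 < c2 & c2 < 3 * r + 5],
              [/\ a2 < c2, a2 <> c1, a3 <> c1 & a3 <> c2] &
            [/\ a2 <= r + 1 + (c1 < a2),
                a3 <= 2 * r + 2 + (c1 < a3) + (c2 < a3),
                r + 1 + (a2 < c1) + (a3 < c1) <= c1 &
                2 * r + 3 + (a3 < c2) <= c2]]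
    (admissible r a3 c1 a2 c2).
Proof.
rewrite /admissible /band !geq_max !leq_min; apply: (iffP idP).
  case/or4P => [||| /orP []]; case/and4P => /andP [? ?] /andP [? ?] /andP [? ?] /andP [? ?];
    split; split; lia.
case=> -[A1 A2 A3] [C1 C2 C3] [D1 D2 D3 D4] [B1 B2 B3 B4].
(* Of the eight outcomes three contradict a2 < a3 or c1 < c2; the other five are the disjuncts, in
   order. *)
have [h1|h1] := ltnP a2 c1; have [h2|h2] := ltnP a3 c1; have [h3|h3] := ltnP a3 c2.
all: try by exfalso; lia.
- by apply/orP; left; lia.
- by apply/or4P/Or42; lia.
- by apply/or4P/Or43; lia.
- by apply/or4P/Or44/orP; left; lia.
- by apply/or4P/Or44/orP; right; lia.
Qed.

Lemma nat_of_orb (a b : bool) : ~~ (a && b) -> a || b = a + b :> nat.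
Proof. by case: a b => [] []. Qed.

(** Distinct interleavings exclude one another, so the disjunction becomes a sum; the products are
    nested to fit [sum_bands]. *)
Lemma admissible_split r a3 c1 a2 c2 : admissible r a3 c1 a2 c2 =
  band 2 (2 * r + 3) a3 * (band (maxn a3.+1 (r + 3)) (3 * r + 4) c1 *
    (band 1 (minn a3 (r + 2)) a2 * band (maxn c1.+1 (2 * r + 4)) (3 * r + 5) c2))
  + (band (r + 3) (2 * r + 4) a3 * (band (r + 2) a3 c1 *
    (band 1 (r + 2) a2 * band (2 * r + 4) (3 * r + 5) c2))
  + (band (2 * r + 4) (2 * r + 5) a3 * (band (r + 2) (2 * r + 3) c1 *
    (band 1 (r + 2) a2 * band (2 * r + 3) (2 * r + 4) c2))
  + (band (r + 3) (2 * r + 4) a3 * (band (r + 1) (r + 2) c1 *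
    (band (r + 2) (r + 3) a2 * band (2 * r + 4) (3 * r + 5) c2))
  + band (2 * r + 4) (2 * r + 5) a3 * (band (r + 1) (r + 2) c1 *
    (band (r + 2) (r + 3) a2 * band (2 * r + 3) (2 * r + 4) c2))))) :> nat.
Proof.
by rewrite /admissible !nat_of_orb ?mulnb //; apply/negP; case/andP;
  rewrite /band ?geq_max ?leq_min; lia.
Qed.

Lemma sum_desc l n : 2 * \sum_(l <= x < l + n) (l + n - x) = n * n.+1.
Proof.
elim: n l => [|n IHn] l; first by rewrite addn0 big_geq.
rewrite big_ltn; last by rewrite addnS ltnS leq_addr.
by rewrite -addSnnS mulnDr IHn; lia.
Qed.

Lemma sum_asc l n : 2 * \sum_(l <= x < l + n) (x - l).+1 = n * n.+1.
Proof.
elim: n => [|n IHn]; first by rewrite addn0 big_geq.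
by rewrite addnS big_nat_recr ?leq_addr //= mulnDr IHn; lia.
Qed.

(** Once a3 and c1 are fixed, a2 and c2 range independently, so their sums collapse to interval
    lengths. The bounds by n keep all intervals inside ['I_n]. *)
Lemma sum_bands n (l3 u3 : nat) (l1 u1 l2 u2 l4 u4 : nat -> nat) :
    u3 <= n ->
    (forall a, a < n -> u1 a <= n) -> (forall a, a < n -> u2 a <= n) ->
    (forall c, c < n -> u4 c <= n) ->
  \sum_(a3 < n) \sum_(c1 < n) \sum_(a2 < n) \sum_(c2 < n)
     band l3 u3 a3 * (band (l1 a3) (u1 a3) c1 *
       (band (l2 a3) (u2 a3) a2 * band (l4 c1) (u4 c1) c2)) =
  \sum_(l3 <= a < u3) (u2 a - l2 a) *
     \sum_(l1 a <= c < u1 a) (u4 c - l4 c).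
Proof.
move=> h3 h1 h2 h4; rewrite -(@sum_band n) //; apply: eq_bigr => a3 _.
rewrite -(@sum_band n) ?h1 // -(@sum_band1 n (l2 a3)) ?h2 //.
rewrite !big_distrr; apply: eq_bigr => c1 _ /=.
rewrite -(@sum_band1 n (l4 c1)) ?h4 // !big_distrl !big_distrr /=.
apply: eq_bigr => a2 _; rewrite !big_distrr /=.
by apply: eq_bigr => c2 _; lia.
Qed.

(** Counts the pairs (c1, c2) with c1 > m in the pattern aacc: each c1 below 2r+4 leaves r+1 values
    for c2, the later ones leave r, ..., 1. The factor 2 clears the triangular number. *)
Lemma sum_admissible_upper r m : m < 2 * r + 4 ->
  2 * \sum_(m.+1 <= c < 3 * r + 4) (3 * r + 5 - maxn c.+1 (2 * r + 4)) =
  2 * (r.+1 * (2 * r + 3 - m)) + r * r.+1.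
Proof.
move=> lt_m; rewrite (big_cat_nat (n := 2 * r + 4)) //=; last by lia.
rewrite [X in X + _](eq_big_nat _ _ (F2 := fun=> r.+1)); last by move=> c; lia.
rewrite [X in _ + X](eq_big_nat _ _ (F2 := fun c => 2 * r + 4 + r - c)); last by move=> c; lia.
have -> : 3 * r + 4 = 2 * r + 4 + r by lia.
by rewrite mulnDr sum_desc sum_nat_const_nat; lia.
Qed.

Lemma sum4_split n (F G : 'I_n -> 'I_n -> 'I_n -> 'I_n -> nat) :
  \sum_(a < n) \sum_(b < n) \sum_(c < n) \sum_(d < n) (F a b c d + G a b c d) =
  \sum_(a < n) \sum_(b < n) \sum_(c < n) \sum_(d < n) F a b c d +
  \sum_(a < n) \sum_(b < n) \sum_(c < n) \sum_(d < n) G a b c d.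
Proof.
rewrite -big_split; apply: eq_bigr => a _ /=.
rewrite -big_split; apply: eq_bigr => b _ /=.
rewrite -big_split; apply: eq_bigr => c _ /=.
by rewrite -big_split.
Qed.

(** Pattern aacc. For a3 <= r+2 the range of c1 starts at the constant r+3 and the sum factors; for
    larger a3 there are r+1 values of a2 and c1 starts at a3+1. *)
Lemma sum_admissible_aacc r
    (S := \sum_(2 <= a < 2 * r + 3) (minn a (r + 2) - 1) *
       \sum_(maxn a.+1 (r + 3) <= c < 3 * r + 4) (3 * r + 5 - maxn c.+1 (2 * r + 4))) :
  4 * S = r.+1 * r.+2 * (r.+1 * (3 * r + 2))
    + 2 * r.+1 * (r * r.+1 * r.+1 + r * r * r.+1).
Proof.
pose H m := \sum_(m.+1 <= c < 3 * r + 4) (3 * r + 5 - maxn c.+1 (2 * r + 4)).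
have -> : S = (\sum_(2 <= a < 2 + r.+1) (a - 2).+1) * H (r + 2)
    + r.+1 * \sum_(r + 3 <= a < 2 * r + 3) H a.
  rewrite /S (big_cat_nat (n := 2 + r.+1)) /=; try lia.
  congr (_ + _); [rewrite big_distrl /= | rewrite big_distrr /=].
    apply: eq_big_nat => a Ha; congr (_ * _); first by lia.
    by congr (\sum_(_ <= _ < _) _); lia.
  have -> : 2 + r.+1 = r + 3 by lia.
  apply: eq_big_nat => a Ha; congr (_ * _); first by lia.
  by congr (\sum_(_ <= _ < _) _); lia.
have A := sum_asc 2 r.+1.
have B := sum_admissible_upper r (r + 2).
have C : 2 * \sum_(r + 3 <= a < 2 * r + 3) H a = r.+1 * (r * r.+1) + r * (r * r.+1).
  rewrite big_distrr /=.
  rewrite (eq_big_nat _ _ (F2 := fun a => r.+1 * (2 * (2 * r + 3 - a)) + r * r.+1));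
    last first.
    by move=> a Ha; rewrite sum_admissible_upper; lia.
  rewrite big_split /= -!big_distrr /= sum_nat_const_nat.
  have -> : 2 * r + 3 = r + 3 + r by lia.
  by rewrite sum_desc addKn.
rewrite -/(H (r + 2)) in B.
move: A B C; set X := \sum_(_ <= _ < _) _; set Y := H _; set Z := \sum_(_ <= _ < _) _.
move=> A /(_ ltac:(lia)) B C.
(* The factor 4 is spread so that each sum occurs doubled, as in its closed form. *)
have -> : 4 * (X * Y + r.+1 * Z) = (2 * X) * (2 * Y) + 2 * r.+1 * (2 * Z) by lia.
rewrite A B C; have -> : 2 * r + 3 - (r + 2) = r.+1 by lia.
lia.
Qed.

(** Pattern acac: r+1 choices each for a2 and c2, while those for c1 run through 1, ..., r+1 as a3
    grows. *)
Lemma sum_admissible_acac r :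
  2 * \sum_(r + 3 <= a < 2 * r + 4) (r + 2 - 1) *
        \sum_(r + 2 <= c < a) (3 * r + 5 - (2 * r + 4))
  = r.+1 ^ 3 * r.+2.
Proof.
rewrite (eq_big_nat _ _ (F2 := fun a => r.+1 ^ 2 * (a - (r + 3)).+1)); last first.
  by move=> a Ha; rewrite sum_nat_const_nat; nia.
rewrite -big_distrr /= mulnCA.
have -> : 2 * r + 4 = r + 3 + r.+1 by lia.
by rewrite sum_asc; lia.
Qed.

(** The formula at k = r+1, with the denominator cleared and the cubic term moved to the left since
    subtraction truncates in [nat]. *)
Lemma sum_admissible r (M := 3 * r + 6) :
  4 * \sum_(a3 < M) \sum_(c1 < M) \sum_(a2 < M) \sum_(c2 < M) admissible r a3 c1 a2 c2
    + 2 * r.+1 ^ 3 = 9 * r.+1 ^ 4 + 9 * r.+1 ^ 2 + 4.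
Proof.
under eq_bigr => a3 _ do under eq_bigr => c1 _ do under eq_bigr => a2 _ do
  under eq_bigr => c2 _ do rewrite admissible_split.
rewrite !sum4_split.
rewrite (sum_bands M _ _ (fun a => maxn a.+1 (r + 3)) (fun=> 3 * r + 4) (fun=> 1)
  (fun a => minn a (r + 2)) (fun c => maxn c.+1 (2 * r + 4)) (fun=> 3 * r + 5)); try lia.
rewrite (sum_bands M _ _ (fun=> r + 2) id (fun=> 1) (fun=> r + 2)
  (fun=> 2 * r + 4) (fun=> 3 * r + 5)); try lia.
rewrite (sum_bands M _ _ (fun=> r + 2) (fun=> 2 * r + 3) (fun=> 1) (fun=> r + 2)
  (fun=> 2 * r + 3) (fun=> 2 * r + 4)); try lia.
rewrite (sum_bands M _ _ (fun=> r + 1) (fun=> r + 2) (fun=> r + 2) (fun=> r + 3)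
  (fun=> 2 * r + 4) (fun=> 3 * r + 5)); try lia.
rewrite (sum_bands M _ _ (fun=> r + 1) (fun=> r + 2) (fun=> r + 2) (fun=> r + 3)
  (fun=> 2 * r + 3) (fun=> 2 * r + 4)); try lia.
have := sum_admissible_acac r; have := sum_admissible_aacc r; rewrite /=.
set S1 := \sum_(2 <= _ < _) _ => E1.
set S2 := \sum_(r + 3 <= _ < _) _ => E2.
(* The patterns acca, caac and caca contribute k^2, k^2 and 1, where k = r+1. *)
rewrite !sum_nat_const_nat.
have -> : r + 2 - 1 = r.+1 by lia.
have -> : 2 * r + 5 - (2 * r + 4) = 1 by lia.
have -> : 2 * r + 4 - (2 * r + 3) = 1 by lia.
have -> : 2 * r + 3 - (r + 2) = r.+1 by lia.
have -> : 2 * r + 4 - (r + 3) = r.+1 by lia.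
have -> : 3 * r + 5 - (2 * r + 4) = r.+1 by lia.
have -> : r + 2 - (r + 1) = 1 by lia.
have -> : r + 3 - (r + 2) = 1 by lia.
move: E1 E2; rewrite !expnS !expn0.
move: S1 S2 => S1 S2 E1 E2.
lia.
Qed.
End Counting.

(** * Tableaux of shape (3,3,3) and admissible quadruples *)

Section Bijection.
Local Open Scope nat_scope.

Definition lam3 : 3.-tuple nat := [tuple 3; 3; 3].
Definition dens (r : nat) : 3.-tuple nat := [tuple 1; r; 1].

Lemma lam3E (i : 'I_3) : 3 = tnth lam3 i.
Proof. by case: i => [[|[|[|]]]]. Qed.

(** Coordinates are plain naturals, meaningful below 3 only; the cast is there because the type of
    the column depends on the row. *)
Definition cell_at (i j : nat) : cell lam3 :=
  existT _ (inord i) (cast_ord (lam3E (inord i)) (inord j)).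

Lemma row_cell_at i j : i < 3 -> row_of (cell_at i j) = i :> nat.
Proof. by move=> lt_i; rewrite /row_of /= inordK. Qed.

Lemma col_cell_at i j : j < 3 -> col_of (cell_at i j) = j.
Proof. by move=> lt_j; rewrite /col_of /= inordK. Qed.

Lemma col_lt3 (c : cell lam3) : col_of c < 3.
Proof. by rewrite [X in _ < X](lam3E (row_of c)); apply: ltn_ord. Qed.

Lemma cell_eq (c d : cell lam3) :
  (c == d) = (row_of c == row_of d :> nat) && (col_of c == col_of d).
Proof.
case: c d => [i a] [j b]; apply/eqP/andP => [-> //|[/eqP/val_inj/= eij]].
by rewrite /row_of /= in eij; subst j => /eqP/val_inj/= ->.
Qed.

Lemma weight3 r : weight lam3 (dens r) = 3 * r + 6.
Proof. by rewrite /weight !big_ord_recl big_ord0 !(tnth_nth 0) /=; lia. Qed.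

Section Fillings.
Variable r : nat.
Notation M := (weight lam3 (dens r)).
Implicit Type T : filling lam3 (dens r).

Definition row T x : nat := row_of (T x).
Definition col T x : nat := col_of (T x).

(** Trades dependent cells for natural-number coordinates, on which [lia] can work. *)
Lemma ssvytP T : reflect
  [/\ forall i j, i < 3 -> j < 3 ->
        #|[set x | (row T x == i) && (col T x == j)]| = nth 0 (dens r) i
    & forall x y, row T x <= row T y -> col T x <= col T y ->
        (row T x != row T y) || (col T x != col T y) -> x < y]
  (T \in ssvyt lam3 (dens r)).
Proof.
rewrite inE; apply: (iffP andP) => -[dP sP]; split.
- move=> i j lt_i lt_j; have /eqP := forallP dP (cell_at i j).
  rewrite (tnth_nth 0) row_cell_at // => <-; apply: eq_card => x.
  by rewrite !inE cell_eq row_cell_at // col_cell_at.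
- move=> x y le_r le_c ne.
  have := forallP (forallP sP (T x)) (T y).
  rewrite cell_eq negb_and ne /weakly_se le_r le_c /= => /forall_inP/(_ x).
  by rewrite inE eqxx => /(_ isT)/forall_inP/(_ y); rewrite inE eqxx; apply.
- apply/forallP => c; rewrite (tnth_nth 0) -(dP _ (col_of c)) ?ltn_ord ?col_lt3 //.
  by apply/eqP/eq_card => x; rewrite !inE cell_eq.
apply/forallP => c; apply/forallP => d; apply/implyP => /andP [ne /andP [le_r le_c]].
apply/forall_inP => x; rewrite inE => /eqP xc.
apply/forall_inP => y; rewrite inE => /eqP yd; subst c d.
by apply: sP => //; move: ne; rewrite cell_eq negb_and.
Qed.

(* Quadruples ((a3, c1), (a2, c2)). *)
Definition positions : finType := (('I_M * 'I_M) * ('I_M * 'I_M))%type.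

(** * From positions to a tableau *)

Section Build.
Variables a3 c1 a2 c2 : nat.

Definition tops : seq nat := [:: 0; a2; a3].
Definition bottoms : seq nat := [:: c1; c2; 3 * r + 5].
Definition mids : pred nat := [pred x | (x \notin tops) && (x \notin bottoms)].

Definition build_row (x : nat) : nat :=
  if x \in tops then 0 else if x \in bottoms then 2 else 1.
(** For a middle entry this is the quotient of its rank by r, written as two comparisons to stay
    within linear arithmetic. *)
Definition build_col (x : nat) : nat :=
  if x \in tops then (a2 <= x) + (a3 <= x)
  else if x \in bottoms then (c2 <= x) + (3 * r + 5 <= x)
  else (r <= rank mids x) + (2 * r <= rank mids x).

Definition build : filling lam3 (dens r) :=
  [ffun x : 'I_M => cell_at (build_row x) (build_col x)].

Lemma row_build x : row build x = build_row x.
Proof.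
rewrite /row ffunE row_cell_at // /build_row.
by case: (_ \in tops); case: (_ \in bottoms).
Qed.

Lemma col_build x : col build x = build_col x.
Proof.
rewrite /col ffunE col_cell_at // /build_col.
by do 2 ?[case: ifP => _]; lia.
Qed.

Lemma midsE x :
  mids x = [&& x != 0, x != a2, x != a3, x != c1, x != c2 & x != 3 * r + 5].
Proof. by rewrite /mids /tops /bottoms /= !inE !negb_or -!andbA. Qed.

Lemma mem_tops x : (x \in tops) = [|| x == 0, x == a2 | x == a3].
Proof. by rewrite /tops !inE. Qed.

Lemma mem_bottoms x : (x \in bottoms) = [|| x == c1, x == c2 | x == 3 * r + 5].
Proof. by rewrite /bottoms !inE. Qed.

(** Of the x integers below x, the non-middle ones are counted by the five comparisons: the outer
    entries are distinct, and 3r+5 is never below x. *)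
Lemma rank_mids :
    [/\ 0 < a2, a2 < a3 & a3 < 3 * r + 5] -> [/\ 0 < c1, c1 < c2 & c2 < 3 * r + 5] ->
    [/\ a2 < c2, a2 <> c1, a3 <> c1 & a3 <> c2] ->
  forall x, x <= 3 * r + 5 ->
  rank mids x + (0 < x) + (a2 < x) + (a3 < x) + (c1 < x) + (c2 < x) = x.
Proof.
case=> ? ? ? [? ? ?] [? ? ? ?].
elim=> [|x IHx] le_x; first by rewrite rank0; lia.
rewrite rankS midsE; move: (rank mids x) (IHx (ltnW le_x)) => R RE.
do 5! [case: eqVneq => [?|?]; first by subst; lia]; lia.
Qed.

Hypothesis vP : admissible r a3 c1 a2 c2.

Lemma rank_admissible :
  [/\ rank mids a2 <= r, rank mids a3 <= 2 * r, r <= rank mids c1, 2 * r <= rank mids c2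
   & rank mids (3 * r + 6) = 3 * r].
Proof.
have [h1 h2 h3 [? ? ? ?]] := admissibleP _ _ _ _ _ vP.
have := rank_mids h1 h2 h3; case: h1 h2 h3 => ? ? ? [? ? ?] [? ? ? ?] R.
have [R2 R3 Rc1 Rc2] :
    [/\ a2 <= 3 * r + 5, a3 <= 3 * r + 5, c1 <= 3 * r + 5 & c2 <= 3 * r + 5] by split; lia.
split; [have := R _ R2 | have := R _ R3 | have := R _ Rc1 | have := R _ Rc2 |]; try lia.
(* [rank_mids] stops at 3r+5, which is itself a bottom entry and leaves the rank unchanged. *)
have -> : 3 * r + 6 = (3 * r + 5).+1 by lia.
by have := R _ (leqnn _); rewrite rankS midsE eqxx !andbF; lia.
Qed.

(** Pins down the entry of each outer cell: this yields the outer densities and lets the positions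
    be read back from [build]. *)
Lemma build_special i j x : i = 0 \/ i = 2 -> j < 3 ->
  (build_row x == i) && (build_col x == j) = (x == nth 0 (if i == 0 then tops else bottoms) j).
Proof.
have [[? ? ?] [? ? ?] [? ? ? ?] _] := admissibleP _ _ _ _ _ vP.
rewrite /build_row /build_col mem_tops mem_bottoms.
case=> -> /=; case: j => [|[|[|//]]] _ /=; do 2 ?[case: ifP]; lia.
Qed.

Lemma build_ssvyt : build \in ssvyt lam3 (dens r).
Proof.
have [[? ? ?] [? ? ?] [? ? ? ?] _] := admissibleP _ _ _ _ _ vP.
have [rk1 rk2 rk3 rk4 rkM] := rank_admissible.
have rkP u w : u \notin tops -> u \notin bottoms ->
    (u < w -> rank mids u < rank mids w) /\ (w <= u -> rank mids w <= rank mids u).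
  move=> ut ub; have um : mids u by rewrite /mids /= ut ub.
  by split; [exact: ltn_rank | exact: leq_rank].
apply/ssvytP; split=> [i j lt_i lt_j | x y]; last first.
  rewrite !row_build !col_build /build_row /build_col.
  have : x < 3 * r + 6 by rewrite -weight3.
  have : y < 3 * r + 6 by rewrite -weight3.
  move: (nat_of_ord x) (nat_of_ord y) => {}x {}y lty ltx.
  rewrite [x < y]ltnNge => le1 le2 ne; apply/negP => le_yx; move: le1 le2 ne.
  (* The row order leaves six cases for (x, y): top-top, top-bottom, top-middle, bottom-bottom,
     middle-bottom, middle-middle. *)
  case: ifPn => [|xt]; [|case: ifPn => [|xb]];
    (case: ifPn => [|yt]; [|case: ifPn => [|yb]]) => /=; try by [].
  - by rewrite !mem_tops => xx yy _ le2 ne; lia.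
  - by rewrite mem_tops mem_bottoms => yb xt _ le2 _; lia.
  (* A middle entry before a2 (resp. a3) has rank below r (resp. 2r), hence lies in an earlier
     column. The case of c1 and c2 is dual. *)
  - have := rkP y a2 yt yb; have := rkP y a3 yt yb.
    by move: yt; rewrite !mem_tops => yt h4 h5 xt _ le2 _; lia.
  - by rewrite !mem_bottoms => yb xb _ le2 ne; lia.
  - have := rkP x c1 xt xb; have := rkP x c2 xt xb.
    by move: xb; rewrite !mem_bottoms => xb h4 h5 yb _ le2 _; lia.
  by have := rkP x y xt xb => h _ le2 ne; lia.
have [-> | i1] := eqVneq i 1; last first.
  have i02 : i = 0 \/ i = 2 by lia.
  have lt_p : nth 0 (if i == 0 then tops else bottoms) j < M.
    by rewrite weight3; case: i02 => ->; case: j lt_j => [|[|[|//]]] _ /=; lia.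
  transitivity 1; last by case: i02 => ->.
  apply/eqP/cards1P; exists (Ordinal lt_p); apply/setP => x.
  by rewrite !inE row_build col_build build_special.
(* The density r is rewritten as the length of the rank interval from j r to (j+1) r, the form
   needed for [card_rank_band]. *)
have -> : nth 0 (dens r) 1 = r.+1 * r - r * r.
  by rewrite mulSn addnK.
have <- : j.+1 * r - j * r = r.+1 * r - r * r by rewrite !mulSn !addnK.
rewrite -(@card_rank_band mids M); last first.
  by rewrite weight3 rkM leq_mul2r lt_j orbT.
  by rewrite leq_mul2r leqnSn orbT.
apply: eq_card => x; rewrite !inE row_build col_build /build_row /build_col /mids /=.
case: ifPn => //= xt; case: ifPn => //= xb.
(* All ranks of middle entries are below 3r, which closes the interval of the last column. *)
have := rkP x (3 * r + 6) xt xb.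
rewrite rkM -/mids.
have : x < 3 * r + 6 by rewrite -weight3.
move: (rank _ _) => k ltx [/(_ ltx) ltk _].
case: j lt_j => [|[|[|//]]] _; lia.
Qed.

End Build.
Arguments rank_mids {a3 c1 a2 c2}.
Arguments build_special {a3 c1 a2 c2}.

(** Surjectivity: the positions are read off the outer cells of T, and the rank of a middle entry
    forces its column. *)
Lemma ssvyt_build T : T \in ssvyt lam3 (dens r) ->
  exists v : positions,
    admissible r v.1.1 v.1.2 v.2.1 v.2.2 /\ T = build v.1.1 v.1.2 v.2.1 v.2.2.
Proof.
case/ssvytP => dT sT.
have mem1 i j : i < 3 -> j < 3 -> nth 0 (dens r) i = 1 -> exists p : 'I_M,
   forall x, (row T x == i) && (col T x == j) = (x == p).
  move=> lt_i lt_j di; have /eqP/cards1P [p pE] := etrans (dT i j lt_i lt_j) di.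
  by exists p => x; rewrite -(in_set1 x) -pE inE.
have lt3r x : row T x < 3 by apply: ltn_ord.
have lt3c x : col T x < 3 by apply: col_lt3.
have get i j (p : 'I_M) :
    (forall x, (row T x == i) && (col T x == j) = (x == p)) -> row T p = i /\ col T p = j.
  by move/(_ p); rewrite eqxx => /andP [/eqP ? /eqP ?].
have [a1 a1P] := mem1 0 0 isT isT erefl.
have [a2 a2P] := mem1 0 1 isT isT erefl.
have [a3 a3P] := mem1 0 2 isT isT erefl.
have [c1 c1P] := mem1 2 0 isT isT erefl.
have [c2 c2P] := mem1 2 1 isT isT erefl.
have [c3 c3P] := mem1 2 2 isT isT erefl.
have [ra1 ca1] := get _ _ _ a1P.
have [ra2 ca2] := get _ _ _ a2P.
have [ra3 ca3] := get _ _ _ a3P.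
have [rc1 cc1] := get _ _ _ c1P.
have [rc2 cc2] := get _ _ _ c2P.
have [rc3 cc3] := get _ _ _ c3P.
have M0 : 0 < M by rewrite weight3; lia.
have Mx : 3 * r + 5 < M by rewrite weight3; lia.
(* The corner cells are extremal in the order, so they hold the least and the greatest integer. *)
have a1E : a1 = 0 :> nat.
  apply/eqP; rewrite -leqn0 leqNgt; apply/negP => a1_gt0.
  have := a1P (Ordinal M0); rewrite -val_eqE /= (ltn_eqF a1_gt0).
  move/negbT; rewrite negb_and => ne.
  have := sT a1 (Ordinal M0); rewrite ra1 ca1 !leq0n ![0 == _]eq_sym => /(_ isT isT ne).
  by rewrite ltn0.
have c3E : c3 = 3 * r + 5 :> nat.
  have := c3P (Ordinal Mx); rewrite -val_eqE /= => c3E.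
  apply/eqP; rewrite eq_sym -c3E; apply/negPn/negP; rewrite negb_and => ne.
  have := sT (Ordinal Mx) c3; rewrite rc3 cc3 => /(_ (lt3r _) (lt3c _) ne) /=.
  by have := ltn_ord c3; rewrite [X in _ < X]weight3; lia.
have gt0 z : a1 < z -> 0 < z by rewrite a1E.
have lt_top z : z < c3 -> z < 3 * r + 5 by rewrite c3E.
have h1 : [/\ 0 < a2, a2 < a3 & a3 < 3 * r + 5].
  by split; [apply: gt0 | | apply: lt_top]; apply: sT;
    rewrite ?ra1 ?ca1 ?ra2 ?ca2 ?ra3 ?ca3 ?rc3 ?cc3.
have h2 : [/\ 0 < c1, c1 < c2 & c2 < 3 * r + 5].
  by split; [apply: gt0 | | apply: lt_top]; apply: sT;
    rewrite ?ra1 ?ca1 ?rc1 ?cc1 ?rc2 ?cc2 ?rc3 ?cc3.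
have h3 : [/\ a2 < c2, nat_of_ord a2 <> c1, nat_of_ord a3 <> c1 & nat_of_ord a3 <> c2].
  (* The cells of a2 and c2 are not adjacent; [standard] compares them even when r = 0 and the cell
     between them is empty. *)
  split; first by apply: sT; rewrite ?ra2 ?ca2 ?rc2 ?cc2.
  - by move/val_inj => e; move: rc1; rewrite -e ra2.
  - by move/val_inj => e; move: rc1; rewrite -e ra3.
  by move/val_inj => e; move: rc2; rewrite -e ra3.
pose S := mids a3 c1 a2 c2.
have SE (x : 'I_M) : S x = (row T x == 1).
  rewrite /S midsE -c3E !(inj_eq val_inj).
  have -> : (x != 0 :> nat) = (x != a1) by rewrite -val_eqE /= a1E.
  rewrite -a1P -a2P -a3P -c1P -c2P -c3P.
  by have := lt3r x; have := lt3c x; case: (row T x) (col T x) => [|[|[|]]] // [|[|[|]]].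
(* The rank is split by column: a middle cell contributes r if it lies wholly before x, 0 if wholly
   after, and at most r in general. *)
pose below j x := #|[set y : 'I_M | [&& row T y == 1, col T y == j & y < x]]|.
have rkE (x : 'I_M) : rank S x = below 0 x + below 1 x + below 2 x.
  rewrite -(@card_rank S M) ?(ltnW (ltn_ord x)) // /below -!sum1dep_card.
  rewrite ![\sum_(_ | _) _]big_mkcond -!big_split /=; apply: eq_bigr => y _.
  rewrite SE; have := lt3c y.
  by case: (row T y == 1); case: (y < x); case: (col T y) => [|[|[|]]].
have below_le j x : j < 3 -> below j x <= r.
  move=> lt_j; rewrite -[leqRHS](dT 1 j) //; apply: subset_leq_card.
  by apply/subsetP => y; rewrite !inE => /and3P [-> -> _].
have below_all j x : j < 3 -> (forall y, row T y = 1 -> col T y = j -> y < x) -> below j x = r.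
  move=> lt_j all_lt; rewrite -[RHS](dT 1 j) //; apply: eq_card => y; rewrite !inE.
  by case: eqP => // ry; case: eqP => // cy; rewrite all_lt.
have below_none j x : (forall y, row T y = 1 -> col T y = j -> x < y) -> below j x = 0.
  move=> all_gt; apply: eq_card0 => y; rewrite !inE.
  case: eqP => // ry; case: eqP => // cy; apply/negbTE.
  by rewrite -leqNgt ltnW ?all_gt.
have below_lt (x : 'I_M) : row T x = 1 -> below (col T x) x < r.
  move=> rx; rewrite -[ltnRHS](dT 1 (col T x)) //; apply: proper_card.
  apply/properP; split; last by exists x; rewrite !inE rx !eqxx ?ltnn.
  by apply/subsetP => y; rewrite !inE => /and3P [-> -> _].
have rk := rank_mids h1 h2 h3.
have g : admissible r a3 c1 a2 c2.
  apply/admissibleP; split=> //.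
  have A2 : rank S a2 <= r.
    rewrite rkE !(below_none (_.+1)) ?addn0 ?below_le // => y ry cy;
    by apply: sT; rewrite ?ra2 ?ca2 ?ry ?cy.
  have A3 : rank S a3 <= 2 * r.
    rewrite rkE (below_none 2) => [|y ry cy]; last by apply: sT; rewrite ?ra3 ?ca3 ?ry ?cy.
    by rewrite addn0 mul2n -addnn leq_add ?below_le.
  have C1 : r <= rank S c1.
    rewrite rkE (below_all 0) => [||y ry cy] //; last by apply: sT; rewrite ?rc1 ?cc1 ?ry ?cy.
    by rewrite -addnA leq_addr.
  have C2 : 2 * r <= rank S c2.
    have before_c2 j : j < 2 -> below j c2 = r.
      move=> lt_j; apply: below_all => [|y ry cy]; first exact: ltnW.
      by apply: sT; rewrite ?rc2 ?cc2 ?ry ?cy.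
    rewrite rkE (before_c2 0) ?(before_c2 1) //.
    by rewrite mul2n -addnn leq_addr.
  case: h1 h2 h3 => gt_a2 lt_a a3M [gt_c1 lt_c c2M] [lt_ac ? ? ?].
  (* [rank_mids] at the four entries turns the rank bounds into the inequalities of
     [admissibleP]. *)
  have := rk a3 (ltnW a3M); have := rk c2 (ltnW c2M).
  have := rk a2 (ltnW (ltn_trans lt_a a3M)); have := rk c1 (ltnW (ltn_trans lt_c c2M)).
  rewrite -/S => E1 E2 E3 E4.
  by split; [clear E1 E3 E4 | clear E1 E2 E3 | clear E2 E3 E4 | clear E1 E2 E4]; lia.
exists ((a3, c1), (a2, c2)); split=> //=.
apply/ffunP => x; apply/eqP; rewrite cell_eq.
change ((row T x == row (build a3 c1 a2 c2) x) && (col T x == col (build a3 c1 a2 c2) x)).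
rewrite row_build col_build.
have SEx := SE x; have ltr := lt3r x; have ltc := lt3c x.
have [rx | rx] := eqVneq (row T x) 1; last first.
  have r02 : row T x = 0 \/ row T x = 2 by lia.
  rewrite ![_ T x == _]eq_sym build_special //.
  case: r02 => rx'; rewrite rx' /=; case cx: (col T x) ltc => [|[|[|//]]] _ /=.
  - by have /eqP-> : x == a1 by [rewrite -a1P rx' cx]; rewrite a1E.
  - by rewrite val_eqE -a2P rx' cx.
  - by rewrite val_eqE -a3P rx' cx.
  - by rewrite val_eqE -c1P rx' cx.
  - by rewrite val_eqE -c2P rx' cx.
  by have /eqP-> : x == c3 by [rewrite -c3P rx' cx]; rewrite c3E.
have /andP [xt xb] : S x by rewrite SEx rx.
rewrite rx /build_row /build_col (negbTE xt) (negbTE xb) /= -/S rkE.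
(* Columns to the left are full, those to the right are empty, and x does not count itself; so with
   j the column of x, its rank lies in the interval from j r to (j+1) r, upper end excluded. *)
have lt0 := below_lt x rx.
have all j : j < 3 -> j < col T x -> below j x = r.
  move=> lt_j lt_jx; apply: below_all => // y ry cy.
  by apply: sT; rewrite ?rx ?ry ?cy ?(ltnW lt_jx) ?(ltn_eqF lt_jx) ?orbT.
have none j : col T x < j -> below j x = 0.
  move=> lt_xj; apply: below_none => // y ry cy.
  by apply: sT; rewrite ?rx ?ry ?cy ?(ltnW lt_xj) ?(ltn_eqF lt_xj) ?orbT.
case: (col T x) ltc lt0 all none => [|[|[|//]]] _ lt0 all none.
- by rewrite (none 1) ?(none 2) //; lia.
- by rewrite (all 0) ?(none 2) //; lia.
by rewrite (all 0) ?(all 1) //; lia.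
Qed.

(** * Injectivity and the resulting count *)

Definition build_at (v : positions) := build v.1.1 v.1.2 v.2.1 v.2.2.
Definition admissible_at (v : positions) := admissible r v.1.1 v.1.2 v.2.1 v.2.2.

Lemma build_at_inj : {in [set v | admissible_at v] &, injective build_at}.
Proof.
move=> [[a3 c1] [a2 c2]] [[a3' c1'] [a2' c2']].
rewrite !inE /admissible_at /build_at /= => g g' e.
(* Membership in an outer cell depends on the tableau alone, so both quadruples name the same entry
   there. *)
have rc (x : 'I_M) i j : i = 0 \/ i = 2 -> j < 3 ->
    (x == nth 0 (if i == 0 then tops a3 a2 else bottoms c1 c2) j :> nat) =
    (x == nth 0 (if i == 0 then tops a3' a2' else bottoms c1' c2') j :> nat).
  move=> hi hj; rewrite -(build_special g) // -(build_special g') //.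
  by rewrite -!row_build -!col_build e.
have e2 := rc a2 0 1 (or_introl erefl) isT.
have e3 := rc a3 0 2 (or_introl erefl) isT.
have f1 := rc c1 2 0 (or_intror erefl) isT.
have f2 := rc c2 2 1 (or_intror erefl) isT.
move: e2 e3 f1 f2; rewrite /= !eqxx => /esym/eqP/val_inj-> /esym/eqP/val_inj->.
by move=> /esym/eqP/val_inj-> /esym/eqP/val_inj->.
Qed.

Lemma card_ssvyt : #|ssvyt lam3 (dens r)| =
  \sum_(a3 < M) \sum_(c1 < M) \sum_(a2 < M) \sum_(c2 < M) admissible r a3 c1 a2 c2.
Proof.
have -> : ssvyt lam3 (dens r) = build_at @: [set v | admissible_at v].
  apply/setP => T; apply/idP/imsetP => [/ssvyt_build [v [gv ->]] | [v]].
    by exists v; rewrite ?inE.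
  by rewrite inE => gv ->; apply: build_ssvyt.
rewrite card_in_imset; last exact: build_at_inj.
rewrite -sum1dep_card big_mkcond /=.
rewrite -(pair_bigA _ (fun p q => if admissible_at (p, q) then 1 else 0)) /=.
rewrite -(pair_bigA _ (fun a3 c1 => \sum_q if admissible_at ((a3, c1), q) then 1 else 0)) /=.
apply: eq_bigr => a3 _; apply: eq_bigr => c1 _.
rewrite -(pair_bigA _ (fun a2 c2 => if admissible_at ((a3, c1), (a2, c2)) then 1 else 0)) /=.
by apply: eq_bigr => a2 _; apply: eq_bigr => c2 _; rewrite /admissible_at; case: admissible.
Qed.
End Fillings.
End Bijection.

Theorem proposition3p2 (k : nat) (hk : (1 <= k)%N) :
  (Catalan3 k 3)%:R =
    (9 * k%:R ^+ 4 - 2 * k%:R ^+ 3 + 9 * k%:R ^+ 2) / 4 + 1 :> rat.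
Proof.
case: k hk => // r _.
(* Free of subtraction and division, the identity holds in [nat] and can be cast to [rat]; the
   middle density [k.-1] computes to r. *)
have : (4 * Catalan3 r.+1 3 + 2 * r.+1 ^ 3 = 9 * r.+1 ^ 4 + 9 * r.+1 ^ 2 + 4)%N.
  by rewrite -sum_admissible /Catalan3 [#|_|]card_ssvyt weight3.
move/(congr1 (fun n : nat => n%:R : rat)).
rewrite !(natrX, natrD, natrM).
by lra.
Qed.
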